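(* Let $V$ be any irreducible right module for $\mathbb{C}S$. Then $V$ is finite-dimensional, and the representation is either $1$-dimensional, given by a multiplicative linear functional $\chi$ on $\mathbb{C}S$ with either $\chi(y)=1$ and $\chi(x)\in\mathbb{C}$, or $\chi(x)=0$ and $\chi(y)\in\mathbb{C}\setminus\{0\}$, or is equivalent to one of the form $\pi_{\alpha,\gamma}$. Thus $\mathbb{C}S$ is not right-primitive.
   Context: $S$ is the semigroup with identity generated by $x$ and $y$, subject to $y$ being invertible and $yx=xy^2$; thus $S=\{x^my^n:m\in\mathbb{Z},\ m\ge0,\ n\in\mathbb{Z}\}$ with product $x^my^n\,x^py^q=x^{m+p}y^{n2^p+q}$. $\mathbb{C}S$ is its complex semigroup algebra. Let $\alpha\in\mathbb{C}\setminus\{0\}$ satisfy $\alpha^{2^k}=\alpha$ for some positive integer $k$, with $k$ taken minimal, and let $\gamma\in\mathbb{C}$, $\gamma\ne0$. Let $X$ be the $k\times k$ matrix with $X_{1,k}=1$, $X_{i,i-1}=1$ for $2\le i\le k$ and all other entries $0$ (so $X=[1]$ if $k=1$), and let $Y=\mathrm{diag}(\alpha,\alpha^2,\alpha^4,\dots,\alpha^{2^{k-1}})$. Then $\pi_{\alpha,\gamma}$ is the right representation of $\mathbb{C}S$ on $\mathbb{C}^k$ (matrices acting on row vectors from the right) determined by $x\mapsto\gamma X$, $y\mapsto Y$. A right module $V$ is irreducible if the action is non-zero and $V$ has no submodules other than $(0)$ and $V$. It is faithful if only $0$ annihilates all of $V$. An algebra is right-primitive if it has a faithful irreducible right module. 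*)

(* Defs.v *)
From HB Require Import structures.
From mathcomp Require Import all_boot all_order all_algebra.
From mathcomp Require Import classical_sets reals complex finmap.
From mathcomp Require Import monalg.

Set Implicit Arguments.
Unset Strict Implicit.
Unset Printing Implicit Defensive.
Import Order.TTheory GRing.Theory Num.Theory.
Local Open Scope ring_scope.

(* The ring structure that monalg puts on {malg K[M]} requires M to have no
   units other than 1, which fails for the semigroup below; hence the alias
   monoid_algebra, which carries the convolution product for any monoid M. *)
Section MonoidAlgebra.
Variables (K : comNzRingType) (M : monoidType).

Definition monoid_algebra : Type := {malg K[M]}.
HB.instance Definition _ := GRing.Lmodule.copy monoid_algebra {malg K[M]}.

Implicit Types (a b c : monoid_algebra) (s t : M) (k : K).

Definition malg_mul a b : monoid_algebra :=
  \sum_(s <- msupp a) \sum_(t <- msupp b) << a@_s * b@_t *g (s * t)%g >>.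

Definition malg_one : monoid_algebra := << 1%g >>.

(* Linear extension to the algebra of a map defined on the monoid. *)
Definition malg_lift (V : lmodType K) (h : M -> V) a : V :=
  \sum_(s <- msupp a) a@_s *: h s.

Lemma malg_liftEw (V : lmodType K) (h : M -> V) (d : {fset M}) a :
  (msupp a `<=` d)%fset -> malg_lift h a = \sum_(s <- d) a@_s *: h s.
Proof.
move=> le; rewrite /malg_lift (big_fset_incl _ le) //= => s _ /mcoeff_outdom ->.
by rewrite scale0r.
Qed.

Lemma malg_lift_is_linear (V : lmodType K) (h : M -> V) : linear (malg_lift h).
Proof.
move=> k a b; pose d := (msupp (k *: a + b) `|` (msupp a `|` msupp b))%fset.
have sd1 : (msupp (k *: a + b) `<=` d)%fset by exact: fsubsetUl.
have sd : (msupp a `|` msupp b `<=` d)%fset by exact: fsubsetUr.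
have sda : (msupp a `<=` d)%fset by apply: fsubset_trans sd; exact: fsubsetUl.
have sdb : (msupp b `<=` d)%fset by apply: fsubset_trans sd; exact: fsubsetUr.
rewrite (malg_liftEw h sd1) (malg_liftEw h sda) (malg_liftEw h sdb).
rewrite scaler_sumr -big_split; apply: eq_bigr => s _ /=.
by rewrite mcoeffD mcoeffZ scalerDl scalerA.
Qed.

HB.instance Definition _ (V : lmodType K) (h : M -> V) :=
  GRing.isLinear.Build K monoid_algebra V *:%R (malg_lift h)
    (malg_lift_is_linear h).

Lemma malg_liftU (V : lmodType K) (h : M -> V) k s :
  malg_lift h << k *g s >> = k *: h s.
Proof. by rewrite (malg_liftEw h msuppU_le) big_seq_fset1 mcoeffUU. Qed.

Lemma malgUZ k s : << k *g s >> = k *: (<< s >> : monoid_algebra).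
Proof. by apply/malgP => t; rewrite mcoeffZ !mcoeffU mulrnAr mulr1. Qed.

Lemma malg_ind (P : monoid_algebra -> Prop) :
  (forall k a b, P a -> P b -> P (k *: a + b)) -> P 0 ->
  (forall s, P << s >>) -> forall a, P a.
Proof.
move=> PD P0 PU a; rewrite [a]monalgE.
elim: (enum_fset _) => [|s l IH]; first by rewrite big_nil.
by rewrite big_cons malgUZ; apply: PD.
Qed.

Lemma malg_mulE a b : malg_mul a b =
  malg_lift (fun s => malg_lift (fun t => << (s * t)%g >> : monoid_algebra) b) a.
Proof.
apply: eq_bigr => s _; rewrite scaler_sumr; apply: eq_bigr => t _.
by rewrite scalerA malgUZ.
Qed.

Lemma malg_mul_linearl b : linear (malg_mul^~ b).
Proof. by move=> k a a'; rewrite !malg_mulE linearP. Qed.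

Lemma malg_mul_linearr a : linear (malg_mul a).
Proof.
move=> k b b'; rewrite !malg_mulE /malg_lift scaler_sumr -big_split.
apply: eq_bigr => s _ /=.
by rewrite -!/(malg_lift _ _) linearP scalerDr !scalerA mulrC.
Qed.

Lemma malg_mulUU s t : malg_mul << s >> << t >> = << (s * t)%g >>.
Proof. by rewrite malg_mulE !malg_liftU !scale1r. Qed.

Let mul0l b : malg_mul 0 b = 0.
Proof. by have /eqP := malg_mul_linearl b 1 0 0; rewrite !scale1r addr0 -subr_eq subrr => /eqP <-. Qed.
Let mul0r a : malg_mul a 0 = 0.
Proof. by have /eqP := malg_mul_linearr a 1 0 0; rewrite !scale1r addr0 -subr_eq subrr => /eqP <-. Qed.

Lemma malg_mulA : associative malg_mul.
Proof.
move=> a b c; elim/malg_ind: a => [k a a' IH IH'||s].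
- by rewrite !malg_mul_linearl IH IH'.
- by rewrite !mul0l.
elim/malg_ind: b => [k b b' IH IH'||t].
- by rewrite !(malg_mul_linearl, malg_mul_linearr) IH IH'.
- by rewrite !(mul0l, mul0r).
elim/malg_ind: c => [k c c' IH IH'||u].
- by rewrite !malg_mul_linearr IH IH'.
- by rewrite !mul0r.
by rewrite !malg_mulUU mulgA.
Qed.

Lemma malg_mul1l : left_id malg_one malg_mul.
Proof.
move=> a; elim/malg_ind: a => [k a a' IH IH'||s]; last by rewrite malg_mulUU mul1g.
- by rewrite malg_mul_linearr IH IH'.
- by rewrite mul0r.
Qed.

Lemma malg_mul1r : right_id malg_one malg_mul.
Proof.
move=> a; elim/malg_ind: a => [k a a' IH IH'||s]; last by rewrite malg_mulUU mulg1.
- by rewrite malg_mul_linearl IH IH'.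
- by rewrite mul0l.
Qed.

Lemma malg_mulDl : left_distributive malg_mul +%R.
Proof. by move=> a b c; have := malg_mul_linearl c 1 a b; rewrite !scale1r. Qed.

Lemma malg_mulDr : right_distributive malg_mul +%R.
Proof. by move=> a b c; have := malg_mul_linearr a 1 b c; rewrite !scale1r. Qed.

Lemma malg_one_neq0 : malg_one != 0.
Proof. by apply/eqP/malgP => /(_ 1%g) /eqP; rewrite !mcoeffsE oner_eq0. Qed.

HB.instance Definition _ := GRing.Zmodule_isNzRing.Build monoid_algebra
  malg_mulA malg_mul1l malg_mul1r malg_mulDl malg_mulDr malg_one_neq0.

Lemma malg_scaleAl k a b : k *: (a * b) = (k *: a) * b.
Proof. by rewrite -[k *: a]addr0 [RHS]malg_mul_linearl [malg_mul 0 b]mul0l addr0. Qed.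

Lemma malg_scaleAr k a b : k *: (a * b) = a * (k *: b).
Proof. by rewrite -[k *: b]addr0 [RHS]malg_mul_linearr [malg_mul a 0]mul0r addr0. Qed.

HB.instance Definition _ :=
  GRing.Lmodule_isLalgebra.Build K monoid_algebra malg_scaleAl.
HB.instance Definition _ :=
  GRing.Lalgebra_isAlgebra.Build K monoid_algebra malg_scaleAr.


Lemma malg_mulU s t : (<< s >> : monoid_algebra) * << t >> = << (s * t)%g >>.
Proof. exact: malg_mulUU. Qed.

Lemma malg_lift_mul (A : algType K) (h : M -> A) :
  {morph h : s t / (s * t)%g >-> s * t} -> {morph malg_lift h : a b / a * b}.
Proof.
move=> hM a b; elim/malg_ind: a => [k a a' IH IH'||s].
- by rewrite mulrDl -scalerAl !linearP /= IH IH' mulrDl -scalerAl.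
- by rewrite GRing.mul0r !linear0 GRing.mul0r.
elim/malg_ind: b => [k b b' IH IH'||t].
- by rewrite mulrDr -scalerAr !linearP /= IH IH' mulrDr -scalerAr.
- by rewrite mulr0 !linear0 mulr0.
by rewrite malg_mulU !malg_liftU !scale1r hM.
Qed.

End MonoidAlgebra.

(* The semigroup S, through the normal form of its elements: SElt m n stands
   for x^m y^n. *)
Record semiS := SElt { xdeg : nat; ydeg : int }.

Lemma semiS_pairK :
  cancel (fun s => (xdeg s, ydeg s)) (fun p => SElt p.1 p.2).
Proof. by case. Qed.
HB.instance Definition _ := Choice.copy semiS (can_type semiS_pairK).

Definition semiS_mul (s t : semiS) : semiS :=
  SElt (xdeg s + xdeg t)%N (ydeg s * (2 ^ xdeg t)%N%:Z + ydeg t).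

Lemma semiS_mulA : associative semiS_mul.
Proof.
move=> [m n] [p q] [r l]; congr SElt; rewrite /= ?addnA //.
by rewrite expnD PoszM mulrDl mulrA addrA.
Qed.

Lemma semiS_mul1l : left_id (SElt 0 0) semiS_mul.
Proof. by move=> [m n]; rewrite /semiS_mul /= mul0r add0r. Qed.

Lemma semiS_mul1r : right_id (SElt 0 0) semiS_mul.
Proof. by move=> [m n]; rewrite /semiS_mul /= addn0 mulr1 addr0. Qed.

HB.instance Definition _ :=
  isMonoid.Build semiS semiS_mulA semiS_mul1l semiS_mul1r.

Definition Sx : semiS := SElt 1 0.
Definition Sy : semiS := SElt 0 1.
Definition SyV : semiS := SElt 0 (-1).

Lemma semiS_mulE m n p q :
  (SElt m n * SElt p q)%g = SElt (m + p) (n * (2 ^ p)%N%:Z + q).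
Proof. by []. Qed.

Lemma SyVK : (Sy * SyV = 1 /\ SyV * Sy = 1)%g.
Proof. by []. Qed.

Lemma Syx : (Sy * Sx = Sx * Sy ^+ 2)%g.
Proof. by []. Qed.

Lemma SxXE m : (Sx ^+ m)%g = SElt m 0.
Proof. by elim: m => // m IH; rewrite expgS IH. Qed.

Lemma SyXE n : (Sy ^+ n)%g = SElt 0 n%:Z.
Proof. by elim: n => // n IH; rewrite expgSr IH semiS_mulE mulr1 -PoszD addn1. Qed.

Lemma SyVXE n : (SyV ^+ n)%g = SElt 0 (- n%:Z).
Proof.
elim: n => // n IH; rewrite expgSr IH semiS_mulE mulr1.
by rewrite -opprD -PoszD addn1.
Qed.

Lemma SEltE m n :
  SElt m n = (Sx ^+ m * (if n is Negz p then SyV ^+ p.+1 else Sy ^+ `|n|))%g.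
Proof.
case: n => n; rewrite SxXE ?SyXE ?SyVXE semiS_mulE addn0 mul0r add0r //.
Qed.

Definition CS (K : comNzRingType) := monoid_algebra K semiS.
Definition xS (K : comNzRingType) : CS K := << Sx >>.
Definition yS (K : comNzRingType) : CS K := << Sy >>.

Section RightModules.
Variables (K : fieldType) (A : algType K).

(* The action is not required to be unital: the convention for irreducibility
   below only asks that it be non-zero. *)
Record is_right_module (V : lmodType K) (act : V -> A -> V) : Prop := {
  act_linearl : forall a, linear (act^~ a);
  act_linearr : forall v, linear (act v);
  actM : forall v a b, act v (a * b) = act (act v a) b }.

Definition submodule (V : lmodType K) (act : V -> A -> V) (W : set V) : Prop :=
  [/\ W 0,
      forall (c : K) (u v : V), W u -> W v -> W (c *: u + v) &
      forall (v : V) (a : A), W v -> W (act v a)].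

Definition irreducible_module (V : lmodType K) (act : V -> A -> V) : Prop :=
  (exists (v : V) (a : A), act v a <> 0) /\
  (forall W : set V, submodule act W -> W = set1 0 \/ W = setT).

Definition faithful_module (V : lmodType K) (act : V -> A -> V) : Prop :=
  forall a : A, (forall v : V, act v a = 0) -> a = 0.

Definition equivalent_modules (V1 V2 : lmodType K)
    (act1 : V1 -> A -> V1) (act2 : V2 -> A -> V2) : Prop :=
  exists2 f : {linear V1 -> V2}, bijective f &
    forall (v : V1) (a : A), f (act1 v a) = act2 (f v) a.

Definition right_primitive : Prop :=
  exists (V : lmodType K) (act : V -> A -> V),
    [/\ is_right_module act, irreducible_module act & faithful_module act].

End RightModules.

Definition has_dim (K : fieldType) (V : lmodType K) (n : nat) : Prop :=
  inhabited (Vector.axiom n V).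

Definition finite_dimensional (K : fieldType) (V : lmodType K) : Prop :=
  exists n, has_dim V n.

(* A one-dimensional representation on which each a acts as the scalar chi a;
   being an algebra morphism, chi is in particular non-zero. *)
Definition given_by_functional (K : fieldType) (A : algType K)
    (V : lmodType K) (act : V -> A -> V) (chi : {lrmorphism A -> K | *%R}) : Prop :=
  has_dim V 1 /\ forall v a, act v a = chi a *: v.

Section Pi.
Variables (K : fieldType) (k : nat).

(* Matrices have size k.+1 and indices start at 0, so that the corner entry of
   pi_X has row 0 and column k. *)
Definition pi_X : 'M[K]_k.+1 :=
  \matrix_(i, j) (if i == 0 :> nat then j == k :> nat else j == i.-1 :> nat)%:R.

Definition pi_Y (alpha : K) : 'M[K]_k.+1 :=
  diag_mx (\row_i alpha ^+ (2 ^ i)%N).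

(* The matrix of x^m y^n is (gamma X)^m Y^n, with a possibly negative exponent
   n : int of the invertible matrix Y. *)
Definition pi_rep (alpha gamma : K) : CS K -> 'M[K]_k.+1 :=
  malg_lift (fun s => (gamma *: pi_X) ^+ xdeg s * pi_Y alpha ^ ydeg s).

Definition pi_act (alpha gamma : K) (v : 'rV[K]_k.+1) (a : CS K) : 'rV[K]_k.+1 :=
  v *m pi_rep alpha gamma a.

Definition least_period (alpha : K) (p : nat) : Prop :=
  [/\ (0 < p)%N, alpha ^+ (2 ^ p)%N = alpha &
      forall q : nat, (0 < q)%N -> alpha ^+ (2 ^ q)%N = alpha -> (p <= q)%N].

Variables (alpha gamma : K).
Hypothesis alpha_neq0 : alpha != 0.
Local Notation X := (gamma *: pi_X).
Local Notation Y := (pi_Y alpha).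

Lemma pi_Y_unit : Y \is a GRing.unit.
Proof.
suff: Y \in unitmx by [].
rewrite unitmxE det_diag unitfE.
by apply/prodf_neq0 => i _; rewrite mxE expf_neq0.
Qed.

Lemma pi_rep_x : pi_rep alpha gamma (xS K) = X.
Proof. by rewrite /pi_rep malg_liftU scale1r /= expr1 expr0z mulr1. Qed.

Lemma pi_rep_y : pi_rep alpha gamma (yS K) = Y.
Proof. by rewrite /pi_rep malg_liftU scale1r /= expr0 mul1r expr1z. Qed.

Lemma pi_rep_1 : pi_rep alpha gamma 1 = 1.
Proof. by rewrite /pi_rep malg_liftU scale1r /= expr0 mul1r expr0z. Qed.

Hypothesis alpha_period : alpha ^+ (2 ^ k.+1)%N = alpha.

Lemma pi_YX : Y * X = X * Y ^+ 2.
Proof.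
rewrite -scalerAr -scalerAl; congr (_ *: _); apply/matrixP => i j.
rewrite expr2 mulrA -!mulmxE mul_diag_mx !mul_mx_diag !mxE.
case: i j => [[|i] lti] [j ltj] /=; case: eqP => [->|_];
  rewrite ?mulr0 ?mul0r // mulr1 mul1r -exprD addnn -mul2n -expnS //.
Qed.

Lemma pi_YXn (n : int) (p : nat) : Y ^ n * X ^+ p = X ^+ p * Y ^ (n * (2 ^ p)%N%:Z).
Proof.
elim: p n => [|p IH] n; first by rewrite !expr0 mul1r !mulr1.
suff YX1 m : Y ^ m * X = X * Y ^ (m * 2).
  by rewrite (exprS X) mulrA YX1 -[LHS]mulrA IH -(mulrA n) -PoszM -expnS mulrA.
case: m => m.
  rewrite -PoszM; elim: m => [|m IHm]; first by rewrite mulr1 mul1r.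
  rewrite -[Y ^ m.+1]/(Y ^+ m.+1) exprS -mulrA [Y ^+ m * X]IHm mulrA pi_YX -mulrA.
  by rewrite -[Y ^ (m * 2)%N]/(Y ^+ (m * 2)) -exprD mulSn.
have uY := pi_Y_unit.
rewrite NegzE mulNr -PoszM -!exprnN.
have: X * Y ^+ (m.+1 * 2) = Y ^+ m.+1 * X.
  elim: m {IH} => [|m IHm]; first by rewrite mul1n expr1 pi_YX.
  by rewrite mulSn exprD mulrA -pi_YX -mulrA IHm mulrA -exprS.
move=> E; apply: (can_inj (mulKr (unitrX m.+1 uY))).
rewrite mulrA divrr ?unitrX // mul1r mulrA -E -mulrA divrr ?unitrX // mulr1 //.
Qed.

Lemma pi_rep_mul : {morph pi_rep alpha gamma : a b / a * b}.
Proof.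
apply: malg_lift_mul => -[m n] [p q] /=.
rewrite exprD exprzDr ?pi_Y_unit // -!mulrA; congr (_ * _).
by rewrite !mulrA pi_YXn.
Qed.

Lemma pi_act_is_right_module : is_right_module (pi_act alpha gamma).
Proof.
split=> [a c u v|v c a b|v a b]; rewrite /pi_act.
- by rewrite mulmxDl scalemxAl.
- by rewrite /pi_rep linearP /= mulmxDr scalemxAr.
- by rewrite pi_rep_mul mulmxA.
Qed.

End Pi.

(* Main.v *)
Require Import Defs.
From HB Require Import structures.
From mathcomp Require Import all_boot all_order all_algebra.
From mathcomp Require Import ring boolp classical_sets reals complex finmap.
From mathcomp Require Import monalg.

Set Implicit Arguments.
Unset Strict Implicit.
Unset Printing Implicit Defensive.
Import Order.TTheory GRing.Theory Num.Theory.
Local Open Scope ring_scope.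

(** Let [V] be an irreducible right module, with [x] and [y] acting as linear
operators; the relation [y x = x y^2] gives [v p(y) x = v x p(y^2)] for every
polynomial [p].

The heart of the proof is that some non-zero vector is killed by a non-zero
polynomial in [y] ([irreducible_torsion]). If [v != 0] then, as [y - 1] has no
right inverse, a non-zero element of the algebra kills [v]; thus
[v x^N c_N(y)] is a combination of the [v x^n], [n < N], with coefficients
polynomials in [y], where [c_N != 0] ([irreducible_relation]). Some cyclotomic
polynomial [g] of index [3^(k+1)] is prime to [c_N]. The roots of [g] are
stable under squaring, that is, [g(y)] divides [g(y^2)], so that on the one
hand [V g(y)] is a submodule, and on the other hand the vectors [u] such that
[u t(y)] is a combination of the [v x^n], [n < N], for some [t] prime to [g],
form a submodule. If [g(y)] has no kernel, both submodules are [V]; each [v x^i]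
with [i < N] is then divisible by [g] up to a factor prime to [g], and a
determinant non-zero at the roots of [g] kills [v] ([determinant_torsion]).

Hence [y] has an eigenvector [v], with eigenvalue [al != 0]. The kernel of [x]
is a submodule. If [x = 0] then [v] spans [V], on which the algebra acts by a
functional. Otherwise [x] is injective; then [v] lies in the submodule generated
by [v x], where [y] has only eigenvalues [be] with [be ^+ (2 ^ n) = al] for some
[n > 0], so [al] is periodic under squaring ([eigen_periodic]). As only one of
two opposite non-zero numbers can be periodic, [v x] is an eigenvector for the
periodic square root of [al] ([eigen_act_x]). If [k.+1] is the least period,
[x ^+ k.+1] stabilises the eigenspace of [al] and has an eigenvector [w] in it
([eigen_xy]), and the [w x^i], [i <= k], suitably scaled, form a basis on which
[x] and [y] act by the matrices of the representation ([matrix_model]).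

Finally no irreducible module is faithful: [x y - y x] is killed by every
functional and [y ^+ (2 ^ k.+1) - y] by every matrix model. *)

Lemma pow2_periodM (R : pzSemiRingType) (a : R) k n :
  a ^+ (2 ^ k) = a -> a ^+ (2 ^ (k * n)) = a.
Proof.
move=> ak; elim: n => [|n IH]; first by rewrite muln0.
by rewrite mulnS expnD exprM ak.
Qed.

(** * Polynomials under the substitution X |-> X^2 *)

Section Cyclotomic.
Variable K : numClosedFieldType.
Implicit Types (p q r s : {poly K}) (z : K).

(** The cyclotomic polynomial of index [3 ^ k.+1]. *)
Definition cyclo3 k : {poly K} := 'X^(3 ^ k) ^+ 2 + 'X^(3 ^ k) + 1.

Lemma comp_Xn_X2 n : 'X^n \Po 'X^2 = 'X^n ^+ 2 :> {poly K}.
Proof. by rewrite comp_Xn_poly -!exprM mulnC. Qed.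

(** The roots of [cyclo3 k] are stable under squaring. *)
Lemma dvdp_cyclo3_comp k : cyclo3 k %| (cyclo3 k \Po 'X^2).
Proof.
rewrite /cyclo3 !comp_polyD rmorphXn /= comp_Xn_X2 -polyC1 comp_polyC.
set t := 'X^(3 ^ k); apply/dvdpP; exists (t ^+ 2 - t + 1).
by rewrite polyC1; ring.
Qed.

(** A root of [cyclo3 j] has order [3 ^ j.+1], hence is no root of any later
[cyclo3 k], which takes the value 3 there. *)
Lemma cyclo3_root_uniq j k z : (j < k)%N -> root (cyclo3 j) z ->
  ~~ root (cyclo3 k) z.
Proof.
move=> ltjk; rewrite /root /cyclo3 !hornerE => /eqP z0.
have z3 : z ^+ (3 ^ j.+1) = 1.
  rewrite expnS mulnC exprM; set t := z ^+ _ in z0 *.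
  apply/eqP; rewrite -subr_eq0; apply/eqP.
  by transitivity ((t - 1) * (t ^+ 2 + t + 1)); [ring | rewrite z0 mulr0].
have -> : z ^+ (3 ^ k) = 1.
  by rewrite -(subnKC ltjk) expnD exprM z3 expr1n.
by rewrite expr1n (_ : 1 + 1 + 1 = 3%:R) ?pnatr_eq0 //; ring.
Qed.

Lemma cyclo3_horner1 k : (cyclo3 k).[1] = 3%:R.
Proof. by rewrite /cyclo3 !hornerE !expr1n; ring. Qed.

Lemma cyclo3_neq0 k : cyclo3 k != 0.
Proof.
apply/eqP => g0; have := cyclo3_horner1 k.
by rewrite g0 horner0 => /eqP; rewrite (eqr_nat _ 0 3).
Qed.

Lemma cyclo3_horner0 k : (cyclo3 k).[0] = 1.
Proof. by rewrite /cyclo3 !hornerE !expr0n expn_eq0 /= expr0n !add0r. Qed.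

Lemma cyclo3_root k : exists z, root (cyclo3 k) z.
Proof.
apply/closed_rootP/negP => /size_poly1P[c c0 cE].
have := cyclo3_horner1 k; have := cyclo3_horner0 k.
by rewrite cE !hornerC => -> /eqP; rewrite (eqr_nat _ 1 3).
Qed.

(** Since the [cyclo3 k] have disjoint sets of roots, all but finitely many of
them are coprime to a given polynomial. *)
Lemma exists_coprime_cyclo3 s : s != 0 -> exists k, coprimep s (cyclo3 k).
Proof.
move=> s0; suff [k0 Hk0] : exists k0, forall k, (k0 <= k)%N -> coprimep s (cyclo3 k).
  by exists k0; apply: Hk0.
have [rs ->] := closed_field_poly_normal s.
have c0 : lead_coef s != 0 by rewrite lead_coef_eq0.
elim: rs => [|z rs [k1 IH]].
  by exists 0%N => k _; rewrite big_nil coprimepZl // coprime1p.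
have [k2 Hk2] : exists k2, forall k, (k2 <= k)%N -> ~~ root (cyclo3 k) z.
  case: (pselect (exists j, root (cyclo3 j) z)) => [[j Hj]|Hn].
    by exists j.+1 => k ltjk; apply: cyclo3_root_uniq Hj.
  by exists 0%N => k _; apply/negP => Hk; apply: Hn; exists k.
exists (maxn k1 k2) => k; rewrite geq_max => /andP[le1 le2].
rewrite big_cons scalerAr coprimepMl IH // andbT coprimep_sym.
by rewrite coprimep_XsubC Hk2.
Qed.

Lemma coprime_comp_X2 k s : coprimep s (cyclo3 k) ->
  coprimep (s \Po 'X^2) (cyclo3 k).
Proof.
by move=> cs; apply: coprimep_dvdl (dvdp_cyclo3_comp k) (coprimep_comp_poly _ cs).
Qed.

Lemma coprime_X_cyclo3 k : coprimep 'X (cyclo3 k).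
Proof.
rewrite coprimep_sym -['X]subr0 -polyC0 coprimep_XsubC /root cyclo3_horner0.
exact: oner_neq0.
Qed.

(** For [q] take the polynomial whose roots are the [n]-th powers of those of [p]. *)
Lemma dvdp_comp_Xn (p : {poly K}) n : p != 0 ->
  exists2 q : {poly K}, q != 0 & p %| q \Po 'X^n.
Proof.
move=> p0; have [rs pE] := closed_field_poly_normal p.
exists (\prod_(z <- rs) ('X - (z ^+ n)%:P)).
  by rewrite monic_neq0 // monic_prod_XsubC.
rewrite pE dvdpZl ?lead_coef_eq0 // rmorph_prod /=; elim: rs {pE} => [|z rs IH].
  by rewrite !big_nil.
rewrite !big_cons dvdp_mul // comp_polyB comp_polyX comp_polyC.
by rewrite rmorphXn /= subrXX dvdp_mulr.
Qed.

End Cyclotomic.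

(** * Algebras spanned by monomials x^m y^n with y x = x y^2 *)

(** What the argument uses of the semigroup algebra of S: the relations between
its generators [x], [y] and the inverse [yV] of [y], the fact that their
monomials span it, and that [y - 1] has no right inverse. *)
Record doubling_algebra (K : fieldType) (A : algType K) (x y yV : A) : Prop := {
  doubling_yx : y * x = x * y ^+ 2;
  doubling_yyV : y * yV = 1;
  doubling_yVy : yV * y = 1;
  doubling_ind : forall P : A -> Prop,
    (forall k a b, P a -> P b -> P (k *: a + b)) -> P 0 ->
    (forall m n, P (x ^+ m * y ^+ n)) -> (forall m n, P (x ^+ m * yV ^+ n)) ->
    forall a, P a;
  doubling_y_sub1 : forall a, (y - 1) * a != 1 }.

Section DoublingAlgebra.
Variables (K : fieldType) (A : algType K) (x y yV : A).
Hypothesis HA : doubling_algebra x y yV.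
Implicit Types (a b : A) (p q : {poly K}) (c : K).

Let yx := doubling_yx HA.
Let yyV := doubling_yyV HA.
Let yVy := doubling_yVy HA.

Lemma horner_alg_yx p :
  horner_alg y p * x = x * horner_alg y (p \Po 'X^2).
Proof.
elim/poly_ind: p => [|p c IH].
  by rewrite comp_poly0 !rmorph0 mul0r mulr0.
rewrite comp_polyD comp_polyM comp_polyX comp_polyC !rmorphD !rmorphM /=.
rewrite !horner_algX -expr2 !horner_algC mulrDl mulrDr -mulrA yx mulrA IH -mulrA.
by rewrite -scalerAl -scalerAr mul1r mulr1.
Qed.

Lemma horner_alg_yyV p : horner_alg y p * yV = yV * horner_alg y p.
Proof.
have cy : horner_alg y p * y = y * horner_alg y p.
  by have := rmorphM (horner_alg y) p 'X; rewrite mulrC rmorphM /= horner_algX.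
by rewrite -[LHS]mul1r -yVy -!mulrA (mulrA y) -cy -!mulrA yyV mulr1.
Qed.

Lemma exprVM_doubling n : yV ^+ n * y ^+ n = 1.
Proof. by rewrite -exprMn_comm /GRing.comm ?yVy ?yyV ?expr1n. Qed.

Lemma exprMV_doubling n : y ^+ n * yV ^+ n = 1.
Proof. by rewrite -exprMn_comm /GRing.comm ?yVy ?yyV ?expr1n. Qed.

(** Every element becomes, after multiplication by a power of [y], a
combination of powers of [x] with coefficients polynomials in [y]. *)
Lemma doubling_expansion b : exists d N (c : nat -> {poly K}),
  b * y ^+ d = \sum_(n < N) x ^+ n * horner_alg y (c n).
Proof.
pattern b; apply: (doubling_ind HA)
    => {b} [k a b [d1 [N1 [c1 E1]]] [d2 [N2 [c2 E2]]]||m n|m n].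
- exists (d1 + d2)%N, (N1 + N2)%N, (fun n =>
    (if (n < N1)%N then k *: c1 n * 'X^d2 else 0) +
    (if (n < N2)%N then c2 n * 'X^d1 else 0)).
  rewrite mulrDl {1}exprD mulrA -scalerAl E1 addnC exprD mulrA E2.
  rewrite [RHS](eq_bigr (fun n : 'I__ =>
      (if (n < N1)%N then x ^+ n * horner_alg y (k *: c1 n * 'X^d2) else 0) +
      (if (n < N2)%N then x ^+ n * horner_alg y (c2 n * 'X^d1) else 0))); last first.
    by move=> n _; rewrite rmorphD mulrDr; do 2 case: ifP; rewrite ?rmorph0 ?mulr0.
  rewrite big_split /= -!big_mkcond /=; congr (_ + _).
    rewrite (big_ord_narrow (leq_addr N2 N1)) scaler_sumr mulr_suml.
    apply: eq_bigr => n _ /=; rewrite rmorphM rmorphXn /= linearZ /= horner_algX.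
    by rewrite mulr_algl mulrA scalerAr.
  rewrite (big_ord_narrow (leq_addl N1 N2)) mulr_suml.
  by apply: eq_bigr => n _ /=; rewrite rmorphM rmorphXn /= horner_algX mulrA.
- by exists 0%N, 0%N, (fun => 0); rewrite mul0r big_ord0.
- exists 0%N, m.+1, (fun i => if i == m then 'X^n else 0).
  rewrite big_ord_recr /= eqxx big1 ?add0r => [|i _]; last first.
    by rewrite ltn_eqF // rmorph0 mulr0.
  by rewrite mulr1 rmorphXn /= horner_algX.
exists n, m.+1, (fun i => if i == m then 1 else 0).
rewrite big_ord_recr /= eqxx big1 ?add0r => [|i _]; last first.
  by rewrite ltn_eqF // rmorph0 mulr0.
by rewrite -mulrA exprVM_doubling rmorph1.
Qed.

End DoublingAlgebra.

Section SemigroupAlgebra.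
Variable K : fieldType.

(** The inverse of [yS K]. *)
Definition yVS : CS K := << SyV >>.

Lemma malgXU (s : semiS) n : (<< s >> : CS K) ^+ n = << (s ^+ n)%g >>.
Proof.
elim: n => [|n IH]; first by rewrite expr0 expg0.
rewrite exprS IH expgS malg_mulU; reflexivity.
Qed.

Lemma CS_doubling : doubling_algebra (xS K) (yS K) yVS.
Proof.
have yyV : yS K * yVS = 1 by exact: malg_mulU.
have yVy : yVS * yS K = 1 by exact: malg_mulU.
split; [|exact: yyV|exact: yVy| |].
- rewrite expr2 !malg_mulU; reflexivity.
- move=> P PD P0 PX PV; apply: malg_ind => [||[m [n|n]]]; [exact: PD|exact: P0| |].
    rewrite SEltE -malg_mulU -!malgXU; exact: PX.
  rewrite SEltE -malg_mulU -!malgXU; exact: PV.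
move=> a; apply/eqP => /(congr1 (malg_lift (fun=> 1 : K^o) : CS K -> _)).
rewrite malg_lift_mul => [|? ?]; last by rewrite mulr1.
rewrite linearB /= !malg_liftU !scale1r subrr mul0r => /eqP.
rewrite eq_sym oner_eq0; exact.
Qed.

End SemigroupAlgebra.

(** * Irreducible modules: torsion over the polynomials in y *)

Section RightModule.
Variables (K : numClosedFieldType) (A : algType K) (V : lmodType K) (act : V -> A -> V).
Hypothesis Hmod : is_right_module act.
Local Notation "v ** a" := (act v a) (at level 40, left associativity).
Implicit Types (u v w : V) (a b : A).

Lemma actDl u v a : (u + v) ** a = u ** a + v ** a.
Proof. by have := act_linearl Hmod a 1 u v; rewrite !scale1r. Qed.

Lemma actDr v a b : v ** (a + b) = v ** a + v ** b.
Proof. by have := act_linearr Hmod v 1 a b; rewrite !scale1r. Qed.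

Lemma act0l a : 0 ** a = 0.
Proof. by apply: (addrI (0 ** a)); rewrite -actDl !addr0. Qed.

Lemma act0r v : v ** 0 = 0.
Proof. by apply: (addrI (v ** 0)); rewrite -actDr !addr0. Qed.

Lemma actZl k v a : (k *: v) ** a = k *: (v ** a).
Proof. by have := act_linearl Hmod a k v 0; rewrite !addr0 act0l addr0. Qed.

Lemma actZr k v a : v ** (k *: a) = k *: (v ** a).
Proof. by have := act_linearr Hmod v k a 0; rewrite !addr0 act0r addr0. Qed.

Lemma actNl v a : (- v) ** a = - (v ** a).
Proof. by rewrite -[- v]scaleN1r actZl scaleN1r. Qed.

Lemma actNr v a : v ** (- a) = - (v ** a).
Proof. by rewrite -[- a]scaleN1r actZr scaleN1r. Qed.

Lemma act_suml I (r : seq I) (P : pred I) (F : I -> V) a :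
  (\sum_(i <- r | P i) F i) ** a = \sum_(i <- r | P i) (F i ** a).
Proof. by apply: (big_morph (act^~ a)) => [u v|]; rewrite ?actDl ?act0l. Qed.

Lemma act_sumr I (r : seq I) (P : pred I) (F : I -> A) v :
  v ** (\sum_(i <- r | P i) F i) = \sum_(i <- r | P i) (v ** F i).
Proof. by apply: (big_morph (act v)) => [a b|]; rewrite ?actDr ?act0r. Qed.

Hypothesis Hirr : irreducible_module act.

Lemma irreducible_neq0 : exists v, v != 0.
Proof.
have [[v [a va]] _] := Hirr; exists v; apply/eqP => v0.
by apply: va; rewrite v0 act0l.
Qed.

(** The vectors killed by 1 form a submodule on which the whole algebra acts as
zero, so an irreducible module is unital. *)
Lemma irreducible_act1 v : v ** 1 = v.
Proof.
pose W : set V := fun v => v ** 1 = 0.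
have [||] := Hirr.2 W.
- split=> [|k u w Wu Ww|u a Wu]; rewrite /W ?act0l //.
    by rewrite actDl actZl Wu Ww scaler0 addr0.
  by rewrite -(actM Hmod) mulr1 -[a]mul1r (actM Hmod) Wu act0l.
- move=> W0; apply/eqP; rewrite -subr_eq0; apply/eqP.
  suff : W (v ** 1 - v) by rewrite W0.
  by rewrite /W actDl actNl -(actM Hmod) mulr1 subrr.
move=> WT; have [[u [a ua]] _] := Hirr; case: ua.
have Wu : W u by rewrite WT.
by rewrite -[a]mul1r (actM Hmod) Wu act0l.
Qed.

Lemma irreducible_cyclic v w : v != 0 -> exists a, w = v ** a.
Proof.
move=> v0; pose W : set V := fun w => exists a, w = v ** a.
have [||WT] := Hirr.2 W; last by have : W w by rewrite WT.
  split=> [|k _ _ [a ->] [b ->]|_ a [b ->]].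
  - by exists 0; rewrite act0r.
  - by exists (k *: a + b); rewrite actDr actZr.
  - by exists (b * a); rewrite (actM Hmod).
move=> W0; suff : W v by rewrite W0 => /eqP; rewrite (negPf v0).
by exists 1; rewrite irreducible_act1.
Qed.

Variables (x y yV : A).
Hypothesis HA : doubling_algebra x y yV.

Lemma act_Xn_stable (W : V -> Prop) a n v :
  (forall u, W u -> W (u ** a)) -> W v -> W (v ** (a ^+ n)).
Proof.
move=> Wa Wv; elim: n => [|n IH]; first by rewrite expr0 irreducible_act1.
by rewrite exprSr (actM Hmod); apply: Wa.
Qed.

(** A non-zero subspace stable under the generators is everything. *)
Lemma irreducible_stable (W : V -> Prop) :
  W 0 -> (forall k u v, W u -> W v -> W (k *: u + v)) ->
  (forall v, W v -> W (v ** x)) -> (forall v, W v -> W (v ** y)) ->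
  (forall v, W v -> W (v ** yV)) ->
  (exists2 v, v != 0 & W v) -> forall u, W u.
Proof.
move=> W0 WD Wx Wy WyV [v v0 Wv] u.
suff : submodule act (W : set V).
  case/Hirr.2 => WE; last by have : (W : set V) u by rewrite WE.
  by move: Wv; rewrite WE => /eqP; rewrite (negPf v0).
split=> // w a Ww; pattern a; apply: (doubling_ind HA)
  => {a}[k a b Wa Wb||m n|m n].
- by rewrite actDr actZr; apply: WD.
- by rewrite act0r.
- by rewrite (actM Hmod); do 2 apply: act_Xn_stable => //.
- by rewrite (actM Hmod); do 2 apply: act_Xn_stable => //.
Qed.

Lemma actp0 b v : v ** horner_alg b 0 = 0.
Proof. by rewrite rmorph0 act0r. Qed.

Lemma actp1 b v : v ** horner_alg b 1 = v.
Proof. by rewrite rmorph1 irreducible_act1. Qed.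

Lemma actpD b v (p q : {poly K}) :
  v ** horner_alg b (p + q) = v ** horner_alg b p + v ** horner_alg b q.
Proof. by rewrite rmorphD actDr. Qed.

Lemma actpN b v (p : {poly K}) : v ** horner_alg b (- p) = - (v ** horner_alg b p).
Proof. by rewrite rmorphN actNr. Qed.

Lemma actpM b v (p q : {poly K}) :
  v ** horner_alg b (p * q) = v ** horner_alg b p ** horner_alg b q.
Proof. by rewrite rmorphM (actM Hmod). Qed.

Lemma actpMC b v (p q : {poly K}) :
  v ** horner_alg b (p * q) = v ** horner_alg b q ** horner_alg b p.
Proof. by rewrite mulrC actpM. Qed.

Lemma actpX b v : v ** horner_alg b 'X = v ** b.
Proof. by rewrite horner_algX. Qed.

Lemma actpXn b v n : v ** horner_alg b 'X^n = v ** b ^+ n.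
Proof. by rewrite rmorphXn /= horner_algX. Qed.

Lemma actpC b v k : v ** horner_alg b k%:P = k *: v.
Proof. by rewrite horner_algC actZr irreducible_act1. Qed.

(** The right action of the value at [y] of a polynomial. *)
Local Notation "v *y p" := (act v (horner_alg y p))
  (at level 40, left associativity).

Lemma actyx v p : v *y p ** x = v ** x *y (p \Po 'X^2).
Proof. by rewrite -!(actM Hmod) (horner_alg_yx HA). Qed.

Lemma actyyV v p : v *y p ** yV = v ** yV *y p.
Proof. by rewrite -!(actM Hmod) (horner_alg_yyV HA). Qed.

Lemma act_yyV v : v ** y ** yV = v.
Proof. by rewrite -(actM Hmod) (doubling_yyV HA) irreducible_act1. Qed.

Lemma act_yVy v : v ** yV ** y = v.
Proof. by rewrite -(actM Hmod) (doubling_yVy HA) irreducible_act1. Qed.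

(** The vectors [v x^n] satisfy a non-trivial linear relation with polynomials
in [y] as coefficients: otherwise the module would be free, and [v (y - 1)]
would not generate it. *)
Lemma irreducible_relation v : v != 0 -> exists N (c : nat -> {poly K}),
  c N != 0 /\ \sum_(n < N.+1) v ** x ^+ n *y c n = 0.
Proof.
move=> v0; have [v1|v1] := eqVneq (v ** (y - 1)) 0.
  exists 0%N, (fun=> 'X - 1); split; first by rewrite -polyC1 polyXsubC_eq0.
  rewrite big_ord1 expr0 irreducible_act1 actpD actpN actpX actp1.
  by move: v1; rewrite actDr actNr irreducible_act1.
have [a va] := irreducible_cyclic v v1.
pose b := (y - 1) * a - 1.
have vb : v ** b = 0 by rewrite actDr actNr (actM Hmod) -va irreducible_act1 subrr.
have b0 : b != 0 by rewrite subr_eq0 (doubling_y_sub1 HA).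
have [d [N [c bE]]] := doubling_expansion HA b.
have : b * y ^+ d != 0.
  apply: contra_neq b0 => bd0.
  by rewrite -[b]mulr1 -(exprMV_doubling HA d) mulrA bd0 mul0r.
have : v ** (b * y ^+ d) = 0 by rewrite (actM Hmod) vb act0l.
rewrite {}bE; elim: N => [|N IH]; first by rewrite big_ord0 eqxx.
have [cN|cN] := eqVneq (c N) 0.
  by rewrite big_ord_recr /= cN rmorph0 mulr0 addr0.
move=> sum0 _; exists N, c; split=> //.
by rewrite -[RHS]sum0 act_sumr; apply: eq_bigr => n _; rewrite -(actM Hmod).
Qed.


Section PolynomialSpan.
Variables (v : V) (N : nat).

(** The combinations of the [v x^n], [n < N], with coefficients in [K[y]]. *)
Definition xy_span u := exists c : nat -> {poly K},
  u = \sum_(n < N) v ** x ^+ n *y c n.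

Lemma xy_spanD u w : xy_span u -> xy_span w -> xy_span (u + w).
Proof.
move=> [c ->] [e ->]; exists (fun n => c n + e n).
by rewrite -big_split; apply: eq_bigr => n _; rewrite actpD.
Qed.

Lemma xy_span_acty u p : xy_span u -> xy_span (u *y p).
Proof.
move=> [c ->]; exists (fun n => c n * p).
by rewrite act_suml; apply: eq_bigr => n _; rewrite actpM.
Qed.

Lemma xy_span_x n : (n < N)%N -> xy_span (v ** x ^+ n).
Proof.
move=> ltnN; exists (fun i => (i == n)%:R).
rewrite (bigD1 (Ordinal ltnN)) //= eqxx actp1 big1 ?addr0 // => i.
by rewrite -val_eqE /= => /negPf ->; rewrite actp0.
Qed.

Variable g : {poly K}.

(** The same combinations, up to division by polynomials prime to [g]. *)
Definition xy_local_span u := exists2 t, coprimep t g & xy_span (u *y t).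

Lemma xy_local_spanW u : xy_span u -> xy_local_span u.
Proof. by exists 1; [exact: coprime1p | rewrite actp1]. Qed.

Lemma xy_local_spanD u w :
  xy_local_span u -> xy_local_span w -> xy_local_span (u + w).
Proof.
move=> [s cs Hs] [t ct Ht]; exists (s * t); first by rewrite coprimepMl cs.
rewrite actDl; apply: xy_spanD; first by rewrite actpM; apply: xy_span_acty.
by rewrite actpMC; apply: xy_span_acty.
Qed.

Lemma xy_local_span_acty u p : xy_local_span u -> xy_local_span (u *y p).
Proof.
by move=> [s cs Hs]; exists s; rewrite // -actpM actpMC; apply: xy_span_acty.
Qed.

Lemma xy_local_span_div u t :
  coprimep t g -> xy_local_span (u *y t) -> xy_local_span u.
Proof.
move=> ct [s cs Hs]; exists (t * s); first by rewrite coprimepMl ct.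
by rewrite actpM.
Qed.

End PolynomialSpan.

(** Suppose that every [e i], multiplied by some [t i] non-zero at a root [z] of
[g], is a combination of the [e j] with coefficients multiples of [g]. The
matrix [M] of these relations is diagonal with non-zero diagonal at [z], so its
determinant is not zero, and it kills all the [e i]. *)
Lemma determinant_torsion N (e : 'I_N -> V) (t : 'I_N -> {poly K})
    (c : 'I_N -> 'I_N -> {poly K}) g z :
  root g z -> (forall i, ~~ root (t i) z) ->
  (forall i, e i *y t i = \sum_j e j *y (c i j * g)) ->
  exists2 p, p != 0 & forall i, e i *y p = 0.
Proof.
move=> gz tz rel; pose M := \matrix_(i, j) (t i *+ (i == j) - c i j * g).
have rel0 i : \sum_j e j *y M i j = 0.
  under eq_bigr => j _ do rewrite mxE actpD actpN.
  rewrite big_split /= sumrN -rel (bigD1 i) //= eqxx big1 ?addr0 ?subrr // => j.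
  by rewrite eq_sym => /negPf ->; rewrite actp0.
exists (\det M) => [|k].
  suff : (\det M).[z] != 0 by apply: contra_neq => ->; rewrite horner0.
  (* At [z], where [g] vanishes, [M] is the diagonal matrix of the [t i]. *)
  rewrite -horner_evalE -det_map_mx (_ : map_mx _ M = diag_mx (\row_i (t i).[z])).
    by rewrite det_diag; apply/prodf_neq0 => i _; rewrite mxE; apply: tz.
  apply/matrixP => i j; rewrite !mxE /= horner_evalE !hornerE (eqP gz) mulr0 subr0.
  by case: eqP => [->|_]; rewrite ?horner0.
transitivity (\sum_j e j *y (\adj M *m M) k j).
  rewrite mul_adj_mx (bigD1 k) //= mxE eqxx mulr1n big1 ?addr0 // => j.
  by rewrite mxE eq_sym => /negPf ->; rewrite actp0.
transitivity (\sum_i \sum_j e j *y M i j *y (\adj M) k i); last first.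
  by apply: big1 => i _; rewrite -act_suml rel0 act0l.
rewrite exchange_big; apply: eq_bigr => j _ /=.
rewrite mxE rmorph_sum act_sumr.
by apply: eq_bigr => i _; rewrite actpMC.
Qed.

(** Some non-zero vector is killed by a non-zero polynomial in [y]: by
[g = cyclo3 K k], prime to the leading coefficient of a relation between the
[v x^n], if [g] kills one, and otherwise by the determinant above, [V] being
divisible by [g]. *)
Lemma irreducible_torsion : exists v p, [/\ v != 0, p != 0 & v *y p = 0].
Proof.
have [v v0] := irreducible_neq0.
have [[|N] [c [cN rel]]] := irreducible_relation v0.
  move: rel; rewrite big_ord1 expr0 irreducible_act1 => rel.
  by exists v, (c 0%N).
have [k ck] := exists_coprime_cyclo3 cN; pose g := cyclo3 K k.
have [[u [u0 ug]]|tf] := pselect (exists u, u != 0 /\ u *y g = 0).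
  exists u, g; split=> //; exact: cyclo3_neq0.
pose W := xy_local_span v N.+1 g.
have WD k' u w : W u -> W w -> W (k' *: u + w).
  by move=> Wu; apply: xy_local_spanD; rewrite -(actpC y); apply: xy_local_span_acty.
have Wvx n : (n <= N.+1)%N -> W (v ** x ^+ n).
  rewrite leq_eqVlt ltnS => /orP[/eqP ->|ltnN]; last first.
    by apply: xy_local_spanW; apply: xy_span_x.
  exists (c N.+1) => //; exists (fun n => - c n).
  move: rel; rewrite big_ord_recr /= addrC => /eqP; rewrite addr_eq0 => /eqP ->.
  by rewrite -sumrN; apply: eq_bigr => i _; rewrite actpN.
have W0 : W 0.
  by apply: xy_local_spanW; exists (fun=> 0); rewrite big1 // => i _; rewrite actp0.
have Wall : forall u, W u.
  apply: irreducible_stable => //.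
  - move=> u [s cs [e ue]].
    apply: (@xy_local_span_div _ _ _ _ (s \Po 'X^2)); first exact: coprime_comp_X2.
    rewrite -actyx ue act_suml; apply: (big_ind W) => // [u1 u2|n _].
      exact: xy_local_spanD.
    rewrite actyx; apply: xy_local_span_acty.
    by rewrite -(actM Hmod) -exprSr; apply: Wvx.
  - by move=> u Wu; rewrite -actpX; apply: xy_local_span_acty.
  - move=> u Wu; apply: (@xy_local_span_div _ _ _ _ 'X).
      exact: coprime_X_cyclo3.
    by rewrite actpX act_yVy.
  by exists v => //; rewrite -[v]irreducible_act1 -(expr0 x); apply: Wvx.
have divg : forall u, exists u', u = u' *y g.
  apply: irreducible_stable.
  - by exists 0; rewrite act0l.
  - by move=> k' _ _ [u ->] [w ->]; exists (k' *: u + w); rewrite actDl actZl.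
  - move=> _ [u ->]; have /dvdpP[h hE] := dvdp_cyclo3_comp K k.
    by exists (u ** x *y h); rewrite actyx hE actpM.
  - by move=> _ [u ->]; exists (u ** y); rewrite -actpX -actpM actpMC actpX.
  - by move=> _ [u ->]; exists (u ** yV); rewrite actyyV.
  by exists (v *y g); [apply/eqP => vg; apply: tf; exists v | exists v].
have HT (i : 'I_N.+1) : exists tc : {poly K} * (nat -> {poly K}), coprimep tc.1 g /\
    v ** x ^+ i *y tc.1 = \sum_(j < N.+1) v ** x ^+ j *y (tc.2 j * g).
  have [u uE] := divg (v ** x ^+ i); have [t ct [e ue]] := Wall u.
  exists (t, e); split=> //=; rewrite uE -actpM actpMC ue act_suml.
  by apply: eq_bigr => j _; rewrite actpM.
have [tc Htc] := choice HT; have [z gz] := cyclo3_root K k.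
have [||p p0 Hp] := @determinant_torsion _ (fun i : 'I_N.+1 => v ** x ^+ i)
    (fun i => (tc i).1) (fun i j => (tc i).2 j) g z gz.
- by move=> i; apply: coprimep_root gz; rewrite coprimep_sym; apply: (Htc i).1.
- by move=> i; rewrite (Htc i).2.
by exists v, p; split=> //; rewrite -(Hp ord0) expr0 irreducible_act1.
Qed.

(** * Irreducible modules: eigenvectors *)

(** A vector killed by a non-zero polynomial in [b] yields an eigenvector of
[b], inside any set of vectors stable under the operators [b - c]. *)
Lemma eigenvector_of_torsion b (P : V -> Prop) v p :
  (forall w c, P w -> P (w ** b - c *: w)) ->
  P v -> v != 0 -> p != 0 -> v ** horner_alg b p = 0 ->
  exists w c, [/\ P w, w != 0 & w ** b = c *: w].
Proof.
move=> Pb + + p0; have [rs ->] := closed_field_poly_normal p.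
rewrite -mul_polyC => Pv v0 /eqP; rewrite actpMC actpC scaler_eq0.
rewrite lead_coef_eq0 (negPf p0) /=.
elim: rs v Pv v0 => [|z rs IH] v Pv v0; first by rewrite big_nil actp1 (negPf v0).
rewrite big_cons actpM; set w := v ** _.
have wE : w = v ** b - z *: v by rewrite /w actpD actpN actpX actpC.
have [w0 _|w0] := eqVneq w 0; last by apply: IH => //; rewrite wE; apply: Pb.
by exists v, z; split=> //; apply/eqP; rewrite -subr_eq0 -wE w0.
Qed.

Lemma eigen_actp b v al p : v ** b = al *: v -> v ** horner_alg b p = p.[al] *: v.
Proof.
move=> vb; elim/poly_ind: p => [|p c IH]; first by rewrite actp0 horner0 scale0r.
rewrite actpD actpMC actpX actpC vb actZl IH !hornerE scalerDl scalerA.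
by rewrite mulrC.
Qed.

Lemma irreducible_eigenvector : exists v al, v != 0 /\ v ** y = al *: v.
Proof.
have [u [p [u0 p0 up]]] := irreducible_torsion.
have [//|v [al [_ v0 vy]]] :=
  eigenvector_of_torsion (P := fun=> True) _ I u0 p0 up.
by exists v, al.
Qed.

Lemma eigen_neq0 v al : v != 0 -> v ** y = al *: v -> al != 0.
Proof.
move=> + vy; apply: contra_neq => al0.
by rewrite -[v]act_yyV vy al0 scale0r act0l.
Qed.

Lemma eigen_yV v al : v != 0 -> v ** y = al *: v -> v ** yV = al^-1 *: v.
Proof.
move=> v0 vy; have al0 := eigen_neq0 v0 vy.
by rewrite -[in RHS](act_yyV v) vy actZl scalerA mulVf // scale1r.
Qed.

Lemma act_yx v : v ** y ** x = v ** x ** y ** y.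
Proof. by rewrite -!(actM Hmod) (doubling_yx HA) expr2 mulrA. Qed.

(** The kernel of [x] is a submodule. *)
Lemma x_zero_or_injective :
  (forall v, v ** x = 0) \/ (forall v, v ** x = 0 -> v = 0).
Proof.
have [[v [v0 vx]]|inj] := pselect (exists v, v != 0 /\ v ** x = 0); [left|right].
  apply: irreducible_stable.
  - exact: act0l.
  - by move=> k u w ux wx; rewrite actDl actZl ux wx scaler0 addr0.
  - by move=> u ->; rewrite act0l.
  - by move=> u ux; rewrite act_yx ux !act0l.
  - move=> u ux; have := act_yx (u ** yV); rewrite act_yVy ux.
    by move/(congr1 (fun w => w ** yV ** yV)); rewrite !act_yyV !act0l.
  by exists v.
by move=> v vx; apply/eqP/negPn/negP => v0; apply: inj; exists v.
Qed.

Lemma x_zero_scalar : (forall v, v ** x = 0) ->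
  exists v al, [/\ v != 0, al != 0, v ** y = al *: v & forall u, exists k, u = k *: v].
Proof.
move=> x0; have [v [al [v0 vy]]] := irreducible_eigenvector.
exists v, al; split=> //; first exact: eigen_neq0 vy.
apply: irreducible_stable.
- by exists 0; rewrite scale0r.
- by move=> k _ _ [c ->] [d ->]; exists (k * c + d); rewrite scalerDl scalerA.
- by move=> u _; exists 0; rewrite x0 scale0r.
- by move=> _ [c ->]; exists (c * al); rewrite actZl vy scalerA.
- by move=> _ [c ->]; exists (c / al); rewrite actZl (eigen_yV v0 vy) scalerA.
- by exists v => //; exists 1; rewrite scale1r.
Qed.

Section InjectiveX.
Hypothesis x_inj : forall v, v ** x = 0 -> v = 0.

Lemma act_Xn_neq0 v n : v != 0 -> v ** x ^+ n != 0.
Proof.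
move=> v0; elim: n => [|n IH]; first by rewrite expr0 irreducible_act1.
by rewrite exprSr (actM Hmod); apply: contra_neq IH; apply: x_inj.
Qed.

(** Each vector of the submodule generated by [v x] is killed by a product of
polynomials ['X^(2 ^ n.+1) - al%:P]. This submodule contains [v], so one of the
factors vanishes at [al]. *)
Lemma eigen_periodic v al : v != 0 -> v ** y = al *: v ->
  exists k, al ^+ (2 ^ k.+1) = al.
Proof.
move=> v0 vy; pose f n : {poly K} := 'X^(2 ^ n.+1) - al%:P.
have fE n : f n \Po 'X^2 = f n.+1.
  by rewrite /f comp_polyB comp_polyC comp_Xn_X2 -exprM -expnSr.
suff /(_ v)[l /eqP] : forall u, exists l : seq nat, u *y \prod_(n <- l) f n = 0.
   rewrite (eigen_actp _ vy) scaler_eq0 (negPf v0) orbF.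
  rewrite horner_prod prodf_seq_eq0 => /hasP[n _ /=].
  by rewrite /f !hornerE subr_eq0 => /eqP; exists n.
apply: irreducible_stable.
- by exists [::]; rewrite act0l.
- move=> c u w [l ul] [m wm]; exists (l ++ m); rewrite big_cat /= actDl actZl.
  by rewrite actpM ul act0l scaler0 add0r actpMC wm act0l.
- move=> u [l ul]; exists (map S l); rewrite big_map.
  move: (actyx u (\prod_(n <- l) f n)); rewrite ul act0l rmorph_prod /=.
  by under eq_bigr do rewrite fE.
- move=> u [l ul]; exists l.
  by rewrite -(actpX y u) -actpM actpMC ul act0l.
- by move=> u [l ul]; exists l; rewrite -actyyV ul act0l.
exists (v ** x); first by have := act_Xn_neq0 1 v0; rewrite expr1.
exists [:: 0%N]; rewrite big_seq1; have := actyx v ('X - al%:P).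
rewrite actpD actpX actpN actpC vy subrr act0l comp_polyB comp_polyX comp_polyC.
by rewrite /f expn1.
Qed.

(** Of the two square roots of a periodic [al] only [al ^+ (2 ^ k)] is
periodic. *)
Lemma eigen_act_x v al k : v != 0 -> v ** y = al *: v ->
  al ^+ (2 ^ k.+1) = al -> v ** x ** y = al ^+ (2 ^ k) *: (v ** x).
Proof.
move=> v0 vy alk; have al0 := eigen_neq0 v0 vy.
set be := al ^+ _; have be2 : be * be = al by rewrite -expr2 -exprM -expnSr.
(* If [w != 0] it is an eigenvector for [- be], which is then periodic; but [be]
   is periodic too, so that iterated squaring leads to [be = - be]. *)
pose w := v ** x ** y - be *: (v ** x).
have wy : w ** y = (- be) *: w.
  rewrite actDl actNl actZl -act_yx vy actZl scalerBr -be2 scalerA mulNr scaleNr.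
  by rewrite scaleNr opprK addrC.
have [w0|w0] := eqVneq w 0; first by apply/eqP; rewrite -subr_eq0 -/w w0.
have [j /(pow2_periodM k.+1)] := eigen_periodic w0 wy.
rewrite exprNn -signr_odd oddX /= expr0 mul1r mulnC.
rewrite pow2_periodM => [/eqP|]; last by rewrite /be -exprM mulnC exprM alk.
rewrite -addr_eq0 -mulr2n -mulr_natl mulf_eq0 pnatr_eq0 /= => /eqP be0.
by rewrite -be2 be0 mul0r eqxx in al0.
Qed.

Section PeriodicEigenvector.
Variables (al : K) (k : nat).
Hypothesis al_period : al ^+ (2 ^ k.+1) = al.

(** The inverse of squaring on the orbit of [al] is [z |-> z ^+ (2 ^ k)]. *)
Lemma eigen_act_xn v i : v != 0 -> v ** y = al *: v ->
  v ** x ^+ i ** y = al ^+ (2 ^ (k * i)) *: (v ** x ^+ i).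
Proof.
move=> v0 vy; elim: i => [|i IH].
  by rewrite muln0 expn0 expr0 irreducible_act1.
rewrite exprSr (actM Hmod) (eigen_act_x (k := k) (act_Xn_neq0 i v0) IH).
  by rewrite -exprM -expnD mulnSr.
by rewrite -exprM mulnC exprM al_period.
Qed.

(** The algebra generated by [y] and [yV] acts diagonally on the [v x^i], so
these span a submodule. *)
Lemma eigen_x_cyclic v : v != 0 -> v ** y = al *: v ->
  forall u, exists q, u = v ** horner_alg x q.
Proof.
move=> v0 vy.
have diag (la : nat -> K) b : (forall i, v ** x ^+ i ** b = la i *: (v ** x ^+ i)) ->
    forall q, exists r, v ** horner_alg x q ** b = v ** horner_alg x r.
  move=> vb q; exists (\poly_(i < size q) (la i * q`_i)).
  rewrite -{1}[q]coefK !poly_def !rmorph_sum /= !act_sumr act_suml.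
  apply: eq_bigr => i _; rewrite -!mul_polyC !actpMC !actpC !actpXn actZl vb.
  by rewrite scalerA mulrC.
apply: irreducible_stable.
- by exists 0; rewrite actp0.
- by move=> c _ _ [q ->] [r ->]; exists (c%:P * q + r); rewrite actpD actpMC actpC.
- by move=> _ [q ->]; exists (q * 'X); rewrite actpM actpX.
- move=> _ [q ->]; apply: (diag (fun i => al ^+ (2 ^ (k * i)))) => i.
  exact: eigen_act_xn.
- move=> _ [q ->]; apply: (diag (fun i => (al ^+ (2 ^ (k * i)))^-1)) => i.
  by apply: eigen_yV; [apply: act_Xn_neq0 | apply: eigen_act_xn].
by exists v => //; exists 1; rewrite actp1.
Qed.

(** Either [u = v (x^(k+1) - 1)] is zero or [v] belongs to the submodule
generated by [u], itself an eigenvector of [y]. *)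
Lemma eigen_x_torsion v : v != 0 -> v ** y = al *: v ->
  exists2 p, p != 0 & v ** horner_alg x p = 0.
Proof.
move=> v0 vy; pose u := v ** x ^+ k.+1 - v.
have uE : u = v ** horner_alg x ('X^(k.+1) - 1) by rewrite actpD actpN actpXn actp1.
have uy : u ** y = al *: u.
  by rewrite actDl actNl eigen_act_xn // (mulnC k) pow2_periodM // vy scalerBr.
have [u0|u0] := eqVneq u 0.
  by exists ('X^(k.+1) - 1); rewrite -?uE // monic_neq0 // monicXnsubC.
have [q vE] := eigen_x_cyclic u0 uy v.
exists (('X^(k.+1) - 1) * q - 1); last by rewrite actpD actpN actp1 actpM -uE -vE subrr.
apply/eqP => /(congr1 (horner^~ 1)); rewrite !hornerE expr1n subrr mul0r sub0r.
by move/eqP; rewrite oppr_eq0 oner_eq0.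
Qed.

Lemma eigen_xy : (exists2 v, v != 0 & v ** y = al *: v) ->
  exists w c, [/\ w != 0, c != 0, w ** y = al *: w & w ** x ^+ k.+1 = c *: w].
Proof.
case=> v v0 vy; have [p p0 vp] := eigen_x_torsion v0 vy.
have [q q0 /dvdpP[r qE]] := dvdp_comp_Xn k.+1 p0.
have vq : v ** horner_alg (x ^+ k.+1) q = 0.
  transitivity (v ** horner_alg x (q \Po 'X^(k.+1))).
    congr (v ** _); elim/poly_ind: q {q0 qE} => [|q c IH].
      by rewrite comp_poly0 !rmorph0.
    rewrite comp_polyD comp_polyM comp_polyX comp_polyC !rmorphD !rmorphM /= -IH.
    by rewrite rmorphXn /= !horner_algX !horner_algC.
  by rewrite qE actpMC vp act0l.
have [|w [c [wy w0 wx]]] :=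
    eigenvector_of_torsion (P := fun w => w ** y = al *: w) _ vy v0 q0 vq.
  move=> w c wy; have [->|w0] := eqVneq w 0.
    by rewrite act0l scaler0 subr0 act0l scaler0.
  rewrite actDl actNl actZl eigen_act_xn // (mulnC k) pow2_periodM //.
  by rewrite wy scalerBr !scalerA (mulrC c).
exists w, c; split=> //; apply: contra_neq (act_Xn_neq0 k.+1 w0) => c0.
by rewrite wx c0 scale0r.
Qed.

(** * The matrix model of an irreducible module *)

Section MatrixModel.
Variables (ga : K) (w : V).
Hypothesis (al_least : least_period al k.+1) (ga0 : ga != 0) (w0 : w != 0).
Hypothesis (wy : w ** y = al *: w) (wx : w ** x ^+ k.+1 = ga ^+ k.+1 *: w).

(** The basis on which [x] and [y] act as [ga *: pi_X K k] and [pi_Y k al]; the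
vectors of index [0] and [k.+1] are both [w]. *)
Definition model_basis i := ga ^- (k.+1 - i) *: (w ** x ^+ (k.+1 - i)).

Lemma model_basis0 : model_basis 0 = w.
Proof. by rewrite /model_basis subn0 wx scalerA mulVf ?scale1r // expf_neq0. Qed.

Lemma model_basis_last : model_basis k.+1 = w.
Proof. by rewrite /model_basis subnn !expr0 irreducible_act1 invr1 scale1r. Qed.

Lemma model_basis_x i : (i <= k)%N ->
  model_basis i.+1 ** x = ga *: model_basis i.
Proof.
move=> leik; rewrite /model_basis subSS subSn // actZl -(actM Hmod) -exprSr.
by rewrite scalerA (exprS ga) invfM mulrA divff // mul1r.
Qed.

Lemma model_basis_y i : (i <= k)%N ->
  model_basis i ** y = al ^+ (2 ^ i) *: model_basis i.
Proof.
move=> leik; rewrite /model_basis actZl eigen_act_xn // scalerA mulrC -scalerA.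
congr (_ *: _); suff -> : (k * (k.+1 - i) = k.+1 * (k - i) + i)%N.
  by rewrite expnD exprM pow2_periodM.
by rewrite subSn // mulnS mulSn addnAC subnK.
Qed.

Lemma model_basis_neq0 i : model_basis i != 0.
Proof. by rewrite scaler_eq0 invr_eq0 expf_eq0 (negPf ga0) andbF act_Xn_neq0. Qed.

(** This is where the minimality of the period [k.+1] is used. *)
Lemma model_eigenvalues_inj (i j : 'I_k.+1) :
  al ^+ (2 ^ i) = al ^+ (2 ^ j) -> i = j.
Proof.
wlog leij : i j / (i <= j)%N => [H|eqij].
  by case/orP: (leq_total i j) => le eqij; [|apply: esym]; apply: H.
apply/val_inj/eqP; rewrite eqn_leq leij /= -subn_eq0 -leqn0 leqNgt.
apply/negP => ltij; have [_ alk min] := al_least.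
have := min _ ltij; suff -> : al ^+ (2 ^ (j - i)) = al.
  move/(_ erefl); rewrite leqNgt ltnS => /negP; apply.
  by rewrite (leq_trans (leq_subr _ _)) // -ltnS.
move: (congr1 (fun z => z ^+ (2 ^ (k.+1 - i))) eqij).
rewrite -!exprM -!expnD subnKC ?alk 1?ltnW // => E; rewrite [RHS]E.
rewrite (_ : j + _ = k.+1 + (j - i))%N; first by rewrite expnD exprM alk.
by rewrite addnBA 1?ltnW // addnBA // addnC.
Qed.

(** The linear map sending the canonical basis to [model_basis]. *)
Definition model_map (u : 'rV[K]_k.+1) : V := \sum_i u 0 i *: model_basis i.

Lemma model_map_linear : linear model_map.
Proof.
move=> c u v; rewrite /model_map scaler_sumr -big_split; apply: eq_bigr => i _ /=.
by rewrite !mxE scalerDl -scalerA.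
Qed.

Lemma model_map_mulmx (u : 'rV_k.+1) (M : 'M[K]_k.+1) :
  model_map (u *m M) = \sum_i u 0 i *: \sum_j M i j *: model_basis j.
Proof.
rewrite /model_map; under eq_bigr => j _ do rewrite mxE scaler_suml.
rewrite exchange_big; apply: eq_bigr => i _ /=; rewrite scaler_sumr.
by apply: eq_bigr => j _; rewrite -scalerA.
Qed.

Lemma model_map_x (u : 'rV_k.+1) : model_map (u *m (ga *: pi_X K k)) = model_map u ** x.
Proof.
rewrite model_map_mulmx act_suml; apply: eq_bigr => i _; rewrite actZl.
congr (_ *: _); case: (posnP i) => i0.
  rewrite (bigD1 ord_max) //= big1 ?addr0 => [|j jk]; last first.
    by rewrite !mxE i0 eqxx -[k]/(val (@ord_max k)) val_eqE (negPf jk) mulr0 scale0r.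
  rewrite !mxE i0 !eqxx mulr1 model_basis0 -model_basis_last.
  by rewrite model_basis_x.
have lti : (i.-1 < k.+1)%N by rewrite (leq_ltn_trans (leq_pred _)).
rewrite (bigD1 (Ordinal lti)) //= big1 ?addr0 => [|j ji]; last first.
  rewrite !mxE gtn_eqF // -[i.-1]/(val (Ordinal lti)) val_eqE (negPf ji).
  by rewrite mulr0 scale0r.
by rewrite !mxE gtn_eqF //= eqxx mulr1 -{2}(prednK i0) model_basis_x //.
Qed.

Lemma model_map_y (u : 'rV_k.+1) : model_map (u *m pi_Y k al) = model_map u ** y.
Proof.
rewrite model_map_mulmx act_suml; apply: eq_bigr => i _; rewrite actZl.
rewrite model_basis_y -1?ltnS // (bigD1 i) //= big1 ?addr0 => [|j ji].
  by rewrite !mxE eqxx.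
by rewrite !mxE eq_sym (negPf ji) scale0r.
Qed.

(** The [model_basis i], [i <= k], are eigenvectors of [y] for distinct
eigenvalues; [p] below kills all but one of them. *)
Lemma model_map_inj (u : 'rV_k.+1) : model_map u = 0 -> u = 0.
Proof.
move=> u0; apply/rowP => i; rewrite mxE; apply/eqP.
pose p := \prod_(j | j != i) ('X - (al ^+ (2 ^ j))%:P).
have : model_map u *y p = 0 by rewrite u0 act0l.
have basisp (j : 'I_k.+1) : model_basis j *y p = p.[al ^+ (2 ^ j)] *: model_basis j.
  by apply: eigen_actp; apply: model_basis_y; rewrite -ltnS.
rewrite act_suml (bigD1 i) //= big1 => [|j ji].
  rewrite addr0 actZl basisp => /eqP.
  rewrite 2!scaler_eq0 (negPf (model_basis_neq0 _)) orbF => /orP[//|].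
  rewrite horner_prod => /prodf_eq0[j ji]; rewrite !hornerE subr_eq0.
  by move=> /eqP /model_eigenvalues_inj ij; rewrite ij eqxx in ji.
rewrite actZl basisp /p horner_prod (bigD1 j) //= !hornerE subrr mul0r.
by rewrite scale0r scaler0.
Qed.

Variable rep : A -> 'M[K]_k.+1.
Hypotheses (rep_linear : linear rep) (rep1 : rep 1 = 1)
  (repM : {morph rep : a b / a * b})
  (rep_x : rep x = ga *: pi_X K k) (rep_y : rep y = pi_Y k al).

Lemma model_map_act a (u : 'rV_k.+1) : model_map (u *m rep a) = model_map u ** a.
Proof.
have mapD := model_map_linear.
have rep0 : rep 0 = 0.
  by apply: (addrI (rep 0)); have := rep_linear 1 0 0; rewrite !scale1r !addr0.
have map0 : model_map 0 = 0.
  by rewrite /model_map big1 // => i _; rewrite mxE scale0r.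
have mapXn b n (u' : 'rV_k.+1) :
    (forall u : 'rV_k.+1, model_map (u *m rep b) = model_map u ** b) ->
    model_map (u' *m rep (b ^+ n)) = model_map u' ** b ^+ n.
  move=> Hb; elim: n => [|n IH]; first by rewrite expr0 rep1 mulmx1 irreducible_act1.
  by rewrite exprSr repM mulmxA Hb IH (actM Hmod).
have map_x (u' : 'rV_k.+1) : model_map (u' *m rep x) = model_map u' ** x.
  by rewrite rep_x model_map_x.
have map_y (u' : 'rV_k.+1) : model_map (u' *m rep y) = model_map u' ** y.
  by rewrite rep_y model_map_y.
have map_yV (u' : 'rV_k.+1) : model_map (u' *m rep yV) = model_map u' ** yV.
  rewrite -[LHS]act_yyV -map_y -mulmxA mulmxE -repM (doubling_yVy HA).
  by rewrite rep1 mulmx1.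
move: u; pattern a; apply: (doubling_ind HA) => {a}[c a b Ha Hb||m n|m n] u.
- have -> : u *m rep (c *: a + b) = c *: (u *m rep a) + u *m rep b.
    by rewrite rep_linear mulmxDr scalemxAr.
  by rewrite mapD Ha Hb actDr actZr.
- by rewrite rep0 mulmx0 map0 act0r.
- by rewrite repM mulmxA !mapXn // -(actM Hmod).
- by rewrite repM mulmxA !mapXn // -(actM Hmod).
Qed.

Lemma model_map_surj v : exists u : 'rV_k.+1, v = model_map u.
Proof.
move: v; apply: irreducible_stable.
- by exists 0; rewrite /model_map big1 // => i _; rewrite mxE scale0r.
- by move=> c _ _ [u ->] [v ->]; exists (c *: u + v); rewrite model_map_linear.
- by move=> _ [u ->]; exists (u *m rep x); rewrite model_map_act.
- by move=> _ [u ->]; exists (u *m rep y); rewrite model_map_act.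
- by move=> _ [u ->]; exists (u *m rep yV); rewrite model_map_act.
exists w => //; exists (delta_mx 0 0); rewrite -model_basis0 /model_map.
rewrite (bigD1 ord0) //= big1 ?addr0 => [|i i0]; first by rewrite mxE !eqxx scale1r.
by rewrite mxE (negPf i0) andbF scale0r.
Qed.

(** A representation by matrices is equivalent to the module as soon as it takes
the expected values at [x] and [y]. *)
Lemma matrix_model : exists2 f : {linear V -> 'rV[K]_k.+1}, bijective f &
  forall v a, f (v ** a) = f v *m rep a.
Proof.
have [f fE] := choice model_map_surj.
have mapI : injective model_map.
  move=> u u' E; apply/eqP; rewrite -subr_eq0; apply/eqP/model_map_inj.
  by rewrite addrC -scaleN1r model_map_linear E scaleN1r addNr.
have fK : cancel model_map f by move=> u; apply: mapI; rewrite -fE.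
have f_linear : linear f.
  by move=> c u v; apply: mapI; rewrite model_map_linear -!fE.
pose F : {linear V -> 'rV[K]_k.+1} :=
  HB.pack f (GRing.isLinear.Build _ _ _ _ f f_linear).
exists F => [|v a]; first by exists model_map => // v; rewrite /= -fE.
by apply: mapI; rewrite model_map_act /= -!fE.
Qed.

End MatrixModel.
End PeriodicEigenvector.

End InjectiveX.

(** When [x] and [y] act by the scalars [0 = chi x] and [chi y], the whole
algebra acts through [chi]. *)
Lemma functional_action (chi : {lrmorphism A -> K | *%R}) :
  chi x = 0 -> (forall v, v ** x = 0) -> (forall v, v ** y = chi y *: v) ->
  forall v a, v ** a = chi a *: v.
Proof.
move=> chix x0 vy v a; move: v.
have vyV v : v ** yV = chi yV *: v.
  rewrite -[in RHS](act_yyV v) vy actZl scalerA -rmorphM (doubling_yVy HA).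
  by rewrite rmorph1 scale1r.
have vXn b n : (forall v, v ** b = chi b *: v) ->
    forall v, v ** b ^+ n = chi (b ^+ n) *: v.
  move=> vb v; rewrite rmorphXn /=; elim: n => [|n IH].
    by rewrite !expr0 irreducible_act1 scale1r.
  by rewrite !exprSr (actM Hmod) IH actZl vb scalerA.
have vx v : v ** x = chi x *: v by rewrite x0 chix scale0r.
pattern a; apply: (doubling_ind HA) => {a}[c a b Ha Hb||m n|m n] v.
- by rewrite actDr actZr Ha Hb linearP scalerDl scalerA.
- by rewrite act0r rmorph0 scale0r.
- by rewrite (actM Hmod) !vXn // rmorphM scalerA mulrC.
- by rewrite (actM Hmod) !vXn // rmorphM scalerA mulrC.
Qed.

End RightModule.

(** * Irreducible modules over the algebra of S *)

Section Classification.
Variable K : numClosedFieldType.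

(** On monomials this functional is [x^m y^n |-> 0^m al^n]. *)
Lemma functional_x0 (al : K) : al != 0 ->
  exists chi : {lrmorphism CS K -> K | *%R}, chi (xS K) = 0 /\ chi (yS K) = al.
Proof.
move=> al0; pose h (s : semiS) : K^o := 0 ^+ xdeg s * al ^ ydeg s.
have hM : {morph h : s t / (s * t)%g >-> s * t}.
  case=> [m n] [[|p] q]; rewrite /h /=; last first.
    by rewrite addnS !exprS !mul0r mulr0.
  by rewrite addn0 expr0 mul1r mulr1 expfzDr // mulrA.
pose f : CS K -> K := malg_lift h.
have f_linear : linear_for *%R f by move=> k a b; exact: (malg_lift_is_linear h k a b).
have f_monoid : monoid_morphism f.
  split; last exact: malg_lift_mul hM.
  rewrite /f malg_liftU scale1r /h expr0 mul1r; exact: expr0z.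
pose chi : {lrmorphism CS K -> K | *%R} := HB.pack f
  (GRing.isLinear.Build K (CS K) K *%R f f_linear)
  (GRing.isMonoidMorphism.Build (CS K) K f f_monoid).
exists chi; rewrite /chi /= /f /xS /yS !malg_liftU !scale1r /h /=.
by rewrite expr1 mul0r expr0 mul1r expr1z.
Qed.

Lemma has_dim1 (V : lmodType K) (v : V) :
  v != 0 -> (forall u, exists k, u = k *: v) -> has_dim V 1.
Proof.
move=> v0 /choice[f fE].
have inj k l : k *: v = l *: v -> k = l.
  move/eqP; rewrite -subr_eq0 -scalerBl scaler_eq0 (negPf v0) orbF subr_eq0.
  by move/eqP.
constructor; exists (fun u => (f u)%:M) => [c u w|].
  rewrite scale_scalar_mx -raddfD /=; congr (_%:M); apply: inj.
  by rewrite scalerDl -scalerA -!fE.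
exists (fun M : 'rV[K]_1 => M 0 0 *: v) => [u|M].
  by rewrite mxE eqxx mulr1n -fE.
rewrite [RHS]mx11_scalar; congr (_%:M); apply: inj.
by rewrite -fE.
Qed.

(** When [x] acts injectively the module is always a matrix model, of size one
if [al = 1]; hence only functionals vanishing on [x] occur here. *)
Theorem CS_irreducible (V : lmodType K) (act : V -> CS K -> V) :
  is_right_module act -> irreducible_module act ->
  (exists chi : {lrmorphism CS K -> K | *%R},
     given_by_functional act chi /\ (chi (xS K) = 0 /\ chi (yS K) != 0)) \/
  (exists (k : nat) (al ga : K), [/\ al != 0, least_period al k.+1, ga != 0 &
     equivalent_modules act (@pi_act K k al ga)]).
Proof.
move=> Hmod Hirr; have HA := CS_doubling K.
have [x0|x_inj] := x_zero_or_injective Hmod Hirr HA; [left|right].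
  have [v [al [v0 al0 vy vspan]]] := x_zero_scalar Hmod Hirr HA x0.
  have [chi [chix chiy]] := functional_x0 al0.
  exists chi; rewrite chix chiy; split=> //; split; first exact: has_dim1 vspan.
  apply: (functional_action Hmod Hirr HA chix x0) => u.
  have [k ->] := vspan u.
  by rewrite chiy (actZl Hmod) vy !scalerA mulrC.
have [v [al [v0 vy]]] := irreducible_eigenvector Hmod Hirr HA.
have al0 := eigen_neq0 Hmod Hirr HA v0 vy.
have per : exists k, al ^+ (2 ^ k.+1) == al.
  by have [k /eqP] := eigen_periodic Hmod Hirr HA x_inj v0 vy; exists k.
have [k /eqP alk kmin] := ex_minnP per.
have [|w [c [w0 c0 wy wx]]] := eigen_xy Hmod Hirr HA x_inj alk; first by exists v.
pose ga := k.+1.-root c.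
have gaE : ga ^+ k.+1 = c by rewrite rootCK.
have ga0 : ga != 0 by apply: contra_neq c0 => g0; rewrite -gaE g0 expr0n.
have least : least_period al k.+1.
  by split=> // -[//|q] _ /eqP alq; rewrite ltnS; apply: kmin.
exists k, al, ga; split=> //.
rewrite -gaE in wx.
apply: (matrix_model Hmod Hirr HA x_inj alk least ga0 w0 wy wx).
- by move=> d a b; rewrite /pi_rep linearP.
- exact: pi_rep_1.
- exact: pi_rep_mul.
- exact: pi_rep_x.
- exact: pi_rep_y.
Qed.


Lemma malgU_inj (s t : semiS) : (<< s >> : CS K) = << t >> -> s = t.
Proof.
move=> st; have := congr1 (mcoeff t) st; rewrite mcoeffUU mcoeffU.
case: eqP => // _ /eqP; rewrite mulr0n eq_sym oner_eq0; exact.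
Qed.

Lemma xy_neq_yx : xS K * yS K - yS K * xS K != 0.
Proof.
rewrite subr_eq0 !malg_mulU; apply/eqP => /malgU_inj; discriminate.
Qed.

Lemma yXn_neq_y k : yS K ^+ (2 ^ k.+1) - yS K != 0.
Proof.
rewrite subr_eq0 malgXU SyXE; apply/eqP => /malgU_inj E.
have : (2 ^ k.+1 == 2 ^ 0)%N by case: E => ->.
by rewrite eqn_exp2l.
Qed.

Lemma pi_rep_yXn (k : nat) (al ga : K) : al ^+ (2 ^ k.+1) = al ->
  pi_rep k al ga (yS K ^+ (2 ^ k.+1) - yS K) = 0.
Proof.
move=> alk; rewrite malgXU SyXE /pi_rep linearB /= !malg_liftU !scale1r /=.
rewrite expr0 !mul1r expr1z; apply/eqP; rewrite subr_eq0; apply/eqP.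
rewrite -[LHS]/(pi_Y k al ^+ (2 ^ k.+1)).
have pow n : pi_Y k al ^+ n = diag_mx (\row_i (al ^+ (2 ^ i)) ^+ n).
  elim: n => [|n IH].
    by rewrite expr0; apply/matrixP => i j; rewrite !mxE.
  rewrite exprS IH -mulmxE mulmx_diag; congr diag_mx.
  by apply/rowP => i; rewrite !mxE exprS.
rewrite pow; congr diag_mx; apply/rowP => i; rewrite !mxE.
by rewrite -exprM mulnC exprM alk.
Qed.

Lemma rmorph_commutator (A : algType K) (chi : {lrmorphism A -> K | *%R}) a b :
  chi (a * b - b * a) = 0.
Proof. by rewrite rmorphB !rmorphM mulrC subrr. Qed.

(** Both kinds of irreducible modules have an annihilator: a commutator for a
multiplicative functional, [y ^+ (2 ^ k.+1) - y] for a matrix model. *)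
Lemma CS_not_right_primitive : ~ right_primitive (CS K).
Proof.
case=> V [act [Hmod Hirr faithful]].
have [[chi [[_ actE] _]]|[k [al [ga [al0 [_ alk _] ga0 [f f_bij fE]]]]]] :=
    CS_irreducible Hmod Hirr.
  have := xy_neq_yx; rewrite (faithful (xS K * yS K - yS K * xS K)) ?eqxx // => v.
  rewrite actE rmorph_commutator; exact: scale0r.
have := yXn_neq_y k; rewrite (faithful (yS K ^+ (2 ^ k.+1) - yS K)) ?eqxx // => v.
apply: (bij_inj f_bij); rewrite fE linear0.
rewrite /pi_act pi_rep_yXn; [exact: mulmx0 | exact: alk].
Qed.

End Classification.

Theorem theorem3p3 (R : realType) :
  (forall (V : lmodType R[i]) (act : V -> CS R[i] -> V),
     is_right_module act -> irreducible_module act ->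
     finite_dimensional V /\
     ((exists chi : {lrmorphism CS R[i] -> R[i] | *%R},
         given_by_functional act chi /\
         (chi (yS R[i]) = 1 \/
          (chi (xS R[i]) = 0 /\ chi (yS R[i]) != 0)))
      \/
      (exists (k : nat) (alpha gamma : R[i]),
         [/\ alpha != 0, least_period alpha k.+1, gamma != 0 &
             equivalent_modules act (@pi_act R[i] k alpha gamma)])))
  /\ ~ right_primitive (CS R[i]).
Proof.
split; last exact: CS_not_right_primitive.
move=> V act Hmod Hirr; have [[chi [chiE chixy]]|model] := CS_irreducible Hmod Hirr.
  split; first by exists 1%N; exact: chiE.1.
  by left; exists chi; split=> //; right.
split; last by right.
have [k [al [ga [_ _ _ [f f_bij _]]]]] := model.
by exists k.+1; constructor; exists f => //; apply: linearP.
Qed.
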